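(* For every finite set $A \subset \mathbb{Z}^2$, Picker has a winning strategy in the Chooser-Picker $7$-in-a-row game played on $A$.
   Context: A Chooser-Picker game on a finite hypergraph $(V,\mathcal{F})$, where $\mathcal{F}\subseteq 2^V$, is played as follows. In each round Picker selects two not yet taken vertices of $V$; Chooser takes one of them and the other goes to Picker. If $|V|$ is odd, the single vertex remaining at the end goes to Chooser. Chooser wins if at the end he owns all vertices of some edge $E\in\mathcal{F}$; otherwise Picker wins. Both players have perfect information. The $7$-in-a-row game on $A\subseteq\mathbb{Z}^2$ is the game on the hypergraph with vertex set $A$ whose edges are exactly those sets of the form $\{p, p+d, p+2d, \dots, p+6d\}$ with $p\in\mathbb{Z}^2$ and $d\in\{(1,0),(0,1),(1,1),(1,-1)\}$ (seven consecutive cells in a horizontal, vertical or diagonal line) that are entirely contained in $A$. *)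

(* Defs.v *)
(* points of Z^2 as pairs of integers, finite sets as duplicate-free lists. *)
From Stdlib Require Import ZArith List Bool.
Import ListNotations.
Open Scope Z_scope.
Open Scope bool_scope.

Definition point : Type := (Z * Z)%type.

Definition pt_eqb (p q : point) : bool :=
  Z.eqb (fst p) (fst q) && Z.eqb (snd p) (snd q).

Definition pt_step (p d : point) (k : Z) : point :=
  (fst p + k * fst d, snd p + k * snd d).

Definition dirs : list point := [(1,0); (0,1); (1,1); (1,-1)].

Definition edge_in (A : list point) (p d : point) : Prop :=
  In d dirs /\ forall k, 0 <= k <= 6 -> In (pt_step p d k) A.

Definition chooser_owns_edge (A C : list point) : Prop :=
  exists p d, edge_in A p d /\ forall k, 0 <= k <= 6 -> In (pt_step p d k) C.

Definition rem2 (u v : point) (F : list point) : list point :=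
  filter (fun x => negb (pt_eqb x u) && negb (pt_eqb x v)) F.

(* PickerWins A F C: in the Chooser-Picker 7-in-a-row game on A, from the position
   where F is the list of not-yet-taken vertices and C is the set of vertices
   owned by Chooser, Picker has a winning strategy (Picker's own vertices do not
   affect the outcome).
   - no vertex left: Picker wins iff Chooser owns no edge;
   - one vertex left (|V| odd): it goes to Chooser;
   - otherwise Picker offers two distinct free vertices u, v and must win
     whichever of them Chooser takes. *)
Inductive PickerWins (A : list point) : list point -> list point -> Prop :=
| pw_end : forall C, ~ chooser_owns_edge A C -> PickerWins A [] C
| pw_last : forall v C, ~ chooser_owns_edge A (v :: C) -> PickerWins A [v] C
| pw_move : forall F C u v,
    In u F -> In v F -> u <> v ->
    PickerWins A (rem2 u v F) (u :: C) ->
    PickerWins A (rem2 u v F) (v :: C) ->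
    PickerWins A F C.

(* Main.v *)
(* Cut the plane into 8 x 4 rectangles. In every rectangle there are 32 sets of 2 to 4
   cells such that each line of seven cells contains a set of some rectangle, and Picker
   wins the game with these 32 sets on a single rectangle, by a strategy tree found by
   computer and checked here by evaluation. Since a rectangle has an even number of
   cells, Picker can play a finite union of rectangles one after the other. Finally, cells
   can be deleted from a board on which Picker wins: it does not hurt Picker if Chooser
   gets a cell only later, so a round that would offer a deleted cell can be skipped. This
   passes from a union of rectangles to an arbitrary finite set. *)

Require Import Defs.
From Stdlib Require Import ZArith List Bool Lia Permutation.
Import ListNotations.

(** * Chooser-Picker games with an abstract winning condition *)

Section Game.

Variable T : Type.

Implicit Types (F G : list T) (X Y : T -> Prop) (b : (T -> Prop) -> Prop).

Definition add (u : T) X : T -> Prop := fun x => x = u \/ X x.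

(** Extra cells never hurt Chooser. The condition also lets pointwise equivalent sets be exchanged,
    although they are not equal as predicates. *)
Definition upward b : Prop := forall X Y, (forall x, X x -> Y x) -> b X -> b Y.

(* [picker_wins F b]: the cells of [F] are free, and Chooser wins if the cells he gets
   from now on form a set satisfying [b]; what he already owns is encoded in [b]. *)
Inductive picker_wins : list T -> ((T -> Prop) -> Prop) -> Prop :=
| wins_short : forall F b,
    (length F <= 1)%nat -> ~ b (fun x => In x F) -> picker_wins F b
| wins_offer : forall F G b u v,
    Permutation F (u :: v :: G) ->
    picker_wins G (fun X => b (add u X)) ->
    picker_wins G (fun X => b (add v X)) ->
    picker_wins F b.

Lemma upward_add b u : upward b -> upward (fun X => b (add u X)).
Proof.
  intros Hb X Y HXY. apply Hb. intros x [->|Hx]; [now left | right; auto].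
Qed.

Lemma add_subset F G u v w X :
  Permutation F (u :: v :: G) -> w = u \/ w = v -> (forall x, X x -> In x G) ->
  forall x, add w X x -> In x F.
Proof.
  intros HF Hw HX x Hx. apply (Permutation_in _ (Permutation_sym HF)).
  destruct Hx as [->|Hx].
  - destruct Hw; subst; simpl; auto.
  - right; right; auto.
Qed.

(** The same offers still work. Chooser's future cells all come from [F], so the two conditions are
    compared only on subsets of [F]. *)
Lemma picker_wins_mono F b b' :
  picker_wins F b ->
  (forall X, (forall x, X x -> In x F) -> b' X -> b X) ->
  picker_wins F b'.
Proof.
  intros H; revert b'.
  induction H as [F b HF Hb | F G b u v HF _ IHu _ IHv]; intros b' Hbb'.
  - apply wins_short; auto.
  - apply wins_offer with G u v; [assumption | apply IHu | apply IHv];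
      intros X HX; apply Hbb'; eapply add_subset; eauto.
Qed.

Lemma picker_wins_perm F F' b :
  upward b -> Permutation F F' -> picker_wins F b -> picker_wins F' b.
Proof.
  intros Hb HP H. destruct H as [F b HF Hn | F G b u v HF Hu Hv].
  - apply wins_short; [now rewrite <- (Permutation_length HP)|].
    intros H; apply Hn. revert H; apply Hb. intros x.
    apply Permutation_in, Permutation_sym, HP.
  - apply wins_offer with G u v; trivial. now rewrite <- HP.
Qed.

(** In the game for [b'] Chooser is credited with [y] in advance. Picker follows that strategy while
    holding [y] back to the end, where Chooser receives no more than he was credited with. *)
Lemma picker_wins_release F b b' y :
  picker_wins F b' -> upward b ->
  (forall X, (forall x, X x -> In x F) -> b (add y X) -> b' X) ->
  picker_wins (y :: F) b.
Proof.
  intros H; revert b. induction H as [F b' HF Hn | F G b' u v HF _ IHu _ IHv];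
    intros b Hb Hbb'.
  - assert (Hy : ~ b (add y (fun x => In x F))) by (intros H; apply Hn; auto).
    destruct F as [|v [|? ?]]; [| |simpl in HF; lia].
    + apply wins_short; [simpl; lia|]. intros H; apply Hy; revert H.
      apply Hb. simpl; unfold add; intuition.
    (* Chooser gets only one of [y] and [v] here, while the strategy for [b'] withstands both. *)
    + apply wins_offer with (@nil T) y v; [reflexivity | |];
        (apply wins_short; [simpl; lia|]); intros H; apply Hy; revert H;
        apply Hb; simpl; unfold add; intuition.
  - apply wins_offer with (y :: G) u v.
    + rewrite HF, perm_swap. apply perm_skip, perm_swap.
    + apply IHu; [now apply upward_add|]. intros X HX H. apply Hbb'.
      * eapply add_subset; eauto.
      * revert H; apply Hb. unfold add; intuition.
    + apply IHv; [now apply upward_add|]. intros X HX H. apply Hbb'.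
      * eapply add_subset; eauto.
      * revert H; apply Hb. unfold add; intuition.
Qed.

(* When the strategy offers the missing vertex together with [v], Picker skips the
   round and pretends that Chooser took [v], which is still free. *)
Lemma picker_wins_remove F0 F b x :
  picker_wins F0 b -> upward b -> Permutation F0 (x :: F) -> picker_wins F b.
Proof.
  intros H; revert F. induction H as [F0 b HF0 Hn | F0 G b u v HF0 Hu IHu Hv IHv];
    intros F Hb HP.
  - rewrite (Permutation_length HP) in HF0; simpl in HF0.
    apply wins_short; [lia|]. intros H; apply Hn; revert H; apply Hb.
    intros y Hy. apply (Permutation_in _ (Permutation_sym HP)). now right.
  - assert (HQ : Permutation (u :: v :: G) (x :: F)) by now rewrite <- HF0.
    assert (Hx : In x (u :: v :: G))
      by (apply (Permutation_in _ (Permutation_sym HQ)); now left).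
    destruct Hx as [->|[->|Hx]].
    + apply Permutation_cons_inv in HQ.
      eapply picker_wins_perm; [exact Hb | exact HQ |].
      now apply picker_wins_release with (fun X => b (add v X)).
    + rewrite perm_swap in HQ. apply Permutation_cons_inv in HQ.
      eapply picker_wins_perm; [exact Hb | exact HQ |].
      now apply picker_wins_release with (fun X => b (add u X)).
    + destruct (in_split _ _ Hx) as (G1 & G2 & ->).
      assert (HG : Permutation (G1 ++ x :: G2) (x :: G1 ++ G2))
        by (symmetry; apply Permutation_middle).
      apply wins_offer with (G1 ++ G2) u v.
      * apply Permutation_cons_inv with x. rewrite <- HQ, HG.
        rewrite (perm_swap x v), (perm_swap x u). reflexivity.
      * apply IHu; [now apply upward_add | exact HG].
      * apply IHv; [now apply upward_add | exact HG].
Qed.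

Lemma picker_wins_subset F A b :
  upward b -> picker_wins F b -> NoDup A -> incl A F -> picker_wins A b.
Proof.
  intros Hb H HA HAF.
  (* [R] collects the cells of [F] outside [A]; they are then deleted one at a time. *)
  assert (HR : exists R, Permutation F (R ++ A)).
  { clear H. induction HA as [|a A Ha HA IH].
    - exists F. now rewrite app_nil_r.
    - destruct IH as [R HR]; [intros x Hx; apply HAF; now right|].
      assert (HaR : In a (R ++ A)) by (rewrite <- HR; apply HAF; now left).
      apply in_app_or in HaR as [HaR|HaR]; [|contradiction].
      destruct (in_split _ _ HaR) as (R1 & R2 & ->).
      exists (R1 ++ R2). rewrite HR, <- !app_assoc. apply Permutation_app_head.
      simpl. apply Permutation_middle. }
  destruct HR as [R HR]. clear HA HAF.
  revert F H HR. induction R as [|x R IH]; intros F H HR.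
  - now apply picker_wins_perm with F.
  - apply IH with (R ++ A); [|reflexivity].
    now apply picker_wins_remove with F x.
Qed.

(** Picker exhausts [F1] before touching [F2]. Evenness ensures that no cell of [F1] is left over to
    be mixed with the second game. *)
Lemma picker_wins_union F1 F2 b b1 b2 :
  picker_wins F1 b1 -> picker_wins F2 b2 -> Nat.Even (length F1) ->
  (forall x, In x F1 -> In x F2 -> False) ->
  upward b1 -> upward b2 ->
  (forall X, (forall x, X x -> In x (F1 ++ F2)) -> b X ->
     b1 (fun x => X x /\ In x F1) \/ b2 (fun x => X x /\ In x F2)) ->
  picker_wins (F1 ++ F2) b.
Proof.
  intros H H2. revert b.
  induction H as [F1 b1 HF Hn | F1 G b1 u v HF _ IHu _ IHv];
    intros b Hev Hdisj Hb1 Hb2 Hb.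
  - assert (F1 = []) as ->.
    { destruct F1 as [|? [|? ?]]; trivial; simpl in *; [|lia].
      destruct Hev; lia. }
    apply picker_wins_mono with b2; trivial. intros X HX HbX.
    destruct (Hb X HX HbX) as [H|H].
    + exfalso; apply Hn; revert H; apply Hb1. intros x [_ Hx]; exact Hx.
    + revert H; apply Hb2. intros x [Hx _]; exact Hx.
  - assert (HGF : forall x, In x G -> In x F1).
    { intros x Hx. rewrite HF. right; right; exact Hx. }
    assert (HFF : Permutation (F1 ++ F2) (u :: v :: G ++ F2))
      by (now rewrite HF).
    assert (HevG : Nat.Even (length G)).
    { destruct Hev as [m Hm]. rewrite (Permutation_length HF) in Hm. simpl in Hm.
      exists (m - 1)%nat. lia. }
    (* Whichever cell Chooser takes, it lies in [F1]: it is recorded in [b1], and by disjointness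
       [b2] does not see it. *)
    assert (Hstep : forall w, w = u \/ w = v -> forall X,
              (forall x, X x -> In x (G ++ F2)) -> b (add w X) ->
              b1 (add w (fun x => X x /\ In x G)) \/ b2 (fun x => X x /\ In x F2)).
    { intros w Hw X HX HbX.
      destruct (Hb (add w X)) as [H|H]; trivial.
      - eapply add_subset; eauto.
      - left; revert H; apply Hb1. intros x [[->|Hx] HxF]; [now left|right].
        split; trivial. specialize (HX x Hx). apply in_app_or in HX as [HX|HX]; trivial.
        now destruct (Hdisj x HxF).
      - right; revert H; apply Hb2. intros x [[->|Hx] HxF]; [|now split].
        destruct (Hdisj w); trivial. rewrite HF. destruct Hw; subst; simpl; auto. }
    apply wins_offer with (G ++ F2) u v; trivial;
      [apply IHu | apply IHv]; eauto using upward_add.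
Qed.

(** Arbitrary offers suffice. The induction is on a bound for the length, since each round removes
    two cells. *)
Lemma picker_wins_harmless F b :
  (forall X, (forall x, X x -> In x F) -> ~ b X) -> picker_wins F b.
Proof.
  remember (length F) as n eqn:Hn. assert (Hle : (length F <= n)%nat) by lia.
  clear Hn. revert F b Hle. induction n as [|n IH]; intros F b Hle Hb.
  - apply wins_short; [lia|]. auto.
  - destruct F as [|u [|v G]]; try (apply wins_short; [simpl; lia | auto]).
    apply wins_offer with G u v; [reflexivity| |];
      (apply IH; [simpl in Hle; lia|]); intros X HX; apply Hb;
      eapply add_subset; eauto.
Qed.

End Game.

Arguments add {T}.
Arguments upward {T}.
Arguments picker_wins {T}.

(** The strategy is carried along [f], and Chooser's cells are pulled back to be judged by [b]. This
    moves a strategy from the model rectangle to its translates. *)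
Lemma picker_wins_map (S T : Type) (f : S -> T) (F : list S) (b : (S -> Prop) -> Prop) :
  (forall x y, f x = f y -> x = y) -> upward b -> picker_wins F b ->
  picker_wins (map f F) (fun Y => b (fun x => Y (f x))).
Proof.
  intros Hf Hb H. induction H as [F b HF Hn | F G b u v HF _ IHu _ IHv].
  - apply wins_short; [now rewrite length_map|]. intros H; apply Hn; revert H.
    apply Hb. intros x Hx. apply in_map_iff in Hx as (y & Hy & HyF).
    now apply Hf in Hy as ->.
  - apply wins_offer with (map f G) (f u) (f v).
    + now rewrite HF.
    + eapply picker_wins_mono; [apply IHu, upward_add, Hb|].
      intros Y _; apply Hb. intros x [Hx|Hx]; [left; auto | now right].
    + eapply picker_wins_mono; [apply IHv, upward_add, Hb|].
      intros Y _; apply Hb. intros x [Hx|Hx]; [left; auto | now right].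
Qed.

(** * Verified checking of strategies for a finite list of winning sets *)

Definition hits (H : list (list point)) (X : point -> Prop) : Prop :=
  exists h, In h H /\ forall x, In x h -> X x.

Lemma upward_hits H : upward (hits H).
Proof. intros X Y HXY (h & Hh & HhX). exists h; auto. Qed.

Lemma pt_eqb_spec p q : reflect (p = q) (pt_eqb p q).
Proof.
  destruct p as [x y], q as [x' y']. unfold pt_eqb; simpl.
  destruct (Z.eqb_spec x x'), (Z.eqb_spec y y'); simpl; constructor; congruence.
Qed.

Definition mem (x : point) (l : list point) : bool := existsb (pt_eqb x) l.

Lemma mem_spec x l : reflect (In x l) (mem x l).
Proof.
  apply iff_reflect. unfold mem. rewrite existsb_exists. split.
  - intros H; exists x; split; trivial. now destruct (pt_eqb_spec x x).
  - intros (y & Hy & E). now destruct (pt_eqb_spec x y); subst.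
Qed.

Lemma in_rem2 u v F x : In x (rem2 u v F) <-> In x F /\ x <> u /\ x <> v.
Proof.
  unfold rem2. rewrite filter_In, andb_true_iff, !negb_true_iff.
  destruct (pt_eqb_spec x u), (pt_eqb_spec x v); intuition congruence.
Qed.

(** Without duplicates, the filter removes exactly one entry for each of [u] and [v], so it models
    one round. *)
Lemma rem2_perm u v F :
  NoDup F -> In u F -> In v F -> u <> v -> Permutation F (u :: v :: rem2 u v F).
Proof.
  intros HF Hu Hv Huv. apply NoDup_Permutation; trivial.
  - constructor; [|constructor; [|now apply NoDup_filter]];
      simpl; rewrite in_rem2; intuition.
  - intros x. simpl. rewrite in_rem2.
    destruct (pt_eqb_spec x u), (pt_eqb_spec x v); subst; intuition congruence.
Qed.

(* [H] lists what is left of the winning sets that Picker has not hit. *)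
Definition residual (F : list point) (H : list (list point))
    (b : (point -> Prop) -> Prop) : Prop :=
  forall X, (forall x, X x -> In x F) -> b X -> hits H X.

(** Chooser took [u] and Picker got [v]: sets through [v] are dead, and the others no longer need
    [u]. *)
Definition after (u v : point) (H : list (list point)) : list (list point) :=
  map (rem2 u v) (filter (fun h => negb (mem v h)) H).

(** A pessimistic update independent of Chooser's answer: a set with both cells is dead, and in any
    other set a cell of the pair counts as Chooser's. One recursive call thus serves both
    answers. *)
Definition after_pair (u v : point) (H : list (list point)) : list (list point) :=
  map (rem2 u v) (filter (fun h => negb (mem u h && mem v h)) H).

Definition offerable (u v : point) (F : list point) : bool :=
  mem u F && mem v F && negb (pt_eqb u v).

Lemma offerableP u v F :
  offerable u v F = true -> In u F /\ In v F /\ u <> v.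
Proof.
  unfold offerable. destruct (mem_spec u F), (mem_spec v F), (pt_eqb_spec u v);
    simpl; intuition discriminate.
Qed.

(** As [X] has only cells still free after the round, a set completed by [X] and [u] avoids [v] and
    survives the filter. *)
Lemma residual_after F H b u v :
  u <> v -> In u F -> residual F H b ->
  residual (rem2 u v F) (after u v H) (fun X => b (add u X)).
Proof.
  intros Huv Hu HH X HX HbX.
  destruct (HH (add u X)) as (h & Hh & HhX); trivial.
  { intros x [->|Hx]; trivial. now apply HX, in_rem2 in Hx. }
  exists (rem2 u v h). split.
  - apply in_map, filter_In. split; trivial.
    destruct (mem_spec v h) as [Hv|]; trivial.
    destruct (HhX v Hv) as [->|Hv']; [easy|]. apply HX, in_rem2 in Hv'. tauto.
  - intros x Hx. apply in_rem2 in Hx as (Hx & Hxu & _).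
    destruct (HhX x Hx); [contradiction|trivial].
Qed.

(** A completed set contains at most the cell [w] of the pair, so it is not filtered out, and its
    remaining cells lie in [X]. *)
Lemma residual_after_pair F H b u v w :
  u <> v -> w = u \/ w = v -> In w F -> residual F H b ->
  residual (rem2 u v F) (after_pair u v H) (fun X => b (add w X)).
Proof.
  intros Huv Hw HwF HH X HX HbX.
  destruct (HH (add w X)) as (h & Hh & HhX); trivial.
  { intros x [->|Hx]; trivial. now apply HX, in_rem2 in Hx. }
  assert (Hout : forall x, In x h -> x = u \/ x = v -> x = w).
  { intros x Hx Hxuv. destruct (HhX x Hx) as [|Hx']; trivial.
    apply HX, in_rem2 in Hx'. tauto. }
  exists (rem2 u v h). split.
  - apply in_map, filter_In. split; trivial.
    destruct (mem_spec u h) as [Hu|], (mem_spec v h) as [Hv|]; trivial.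
    destruct Huv. rewrite (Hout u Hu), (Hout v Hv); auto.
  - intros x Hx. apply in_rem2 in Hx as (Hx & Hxu & Hxv).
    destruct (HhX x Hx); [|trivial]. destruct Hw; congruence.
Qed.

Lemma picker_wins_rem2 F b u v :
  NoDup F -> In u F -> In v F -> u <> v ->
  picker_wins (rem2 u v F) (fun X => b (add u X)) ->
  picker_wins (rem2 u v F) (fun X => b (add v X)) ->
  picker_wins F b.
Proof. intros. apply wins_offer with (rem2 u v F) u v; auto using rem2_perm. Qed.

(* Unlike [existsb], stops at the first witness also under call by value. *)
Fixpoint find_some {A : Type} (f : A -> bool) (l : list A) : bool :=
  match l with
  | [] => false
  | x :: l' => if f x then true else find_some f l'
  end.

Lemma find_some_exists (A : Type) (f : A -> bool) l :
  find_some f l = true -> exists x, f x = true.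
Proof.
  induction l as [|x l IH]; simpl; [discriminate|].
  destruct (f x) eqn:E; eauto.
Qed.

(** Serves to select a shortest set. A pairing must place a pair inside it anyway, so branching only
    over its pairs loses nothing and keeps the search small. *)
Definition shorter (h h' : list point) : list point :=
  if (length h' <? length h)%nat then h' else h.

(* Searches for disjoint pairs such that every set of [H] contains one of them. *)
Fixpoint pairable (n : nat) (F : list point) (H : list (list point)) : bool :=
  match H, n with
  | [], _ => true
  | _, O => false
  | h :: H', S n' =>
      let e := fold_left shorter H' h in
      find_some (fun u => find_some (fun v =>
        if offerable u v F then pairable n' (rem2 u v F) (after_pair u v H)
        else false) e) e
  end.

Lemma residual_nil F b : residual F [] b -> picker_wins F b.
Proof.
  intros HH. apply picker_wins_harmless. intros X HX HbX.
  now destruct (HH X HX HbX) as (h & [] & _).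
Qed.

Lemma pairable_sound n F H b :
  pairable n F H = true -> NoDup F -> residual F H b -> picker_wins F b.
Proof.
  revert F H b. induction n as [|n IH]; intros F [|h H] b Hp HF HH;
    try (now apply residual_nil); try discriminate.
  simpl in Hp. apply find_some_exists in Hp as [u Hp].
  apply find_some_exists in Hp as [v Hp].
  destruct (offerable u v F) eqn:E; [|discriminate].
  apply offerableP in E as (Hu & Hv & Huv).
  apply picker_wins_rem2 with u v; trivial;
    (eapply IH; [exact Hp | now apply NoDup_filter |]);
    apply residual_after_pair; auto.
Qed.

(* [Pairing] leaves the pairing strategy to be found by [pairable]; [if_u] is the
   continuation after Chooser took [u]. *)
Inductive strategy : Type :=
| Pairing
| Offer (u v : point) (if_u if_v : strategy).

(** The fuel [length F] is ample for a pairing, as each pair uses up two cells. *)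
Fixpoint wins_with (s : strategy) (F : list point) (H : list (list point)) : bool :=
  match s with
  | Pairing => pairable (length F) F H
  | Offer u v s1 s2 =>
      offerable u v F && wins_with s1 (rem2 u v F) (after u v H)
                      && wins_with s2 (rem2 u v F) (after v u H)
  end.

Lemma rem2_sym u v F : rem2 u v F = rem2 v u F.
Proof. apply filter_ext. intros x. apply andb_comm. Qed.

Lemma wins_with_sound s F H b :
  wins_with s F H = true -> NoDup F -> residual F H b -> picker_wins F b.
Proof.
  revert F H b. induction s as [|u v s1 IH1 s2 IH2]; intros F H b Hs HF HH; simpl in Hs.
  - now apply pairable_sound with (length F) H.
  - apply andb_true_iff in Hs as [Hs Hs2]. apply andb_true_iff in Hs as [Hs Hs1].
    apply offerableP in Hs as (Hu & Hv & Huv).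
    apply picker_wins_rem2 with u v; trivial.
    + apply IH1 with (after u v H); auto using residual_after. now apply NoDup_filter.
    + apply IH2 with (after v u H); trivial; [now apply NoDup_filter|].
      rewrite rem2_sym. apply residual_after; auto.
Qed.

(** * The game on a single 8 x 4 rectangle *)

Definition upto (n : nat) : list Z := map Z.of_nat (seq 0 n).

Definition segment (n : nat) (d p : point) : list point := map (pt_step p d) (upto n).

Definition tile_cells : list point := list_prod (upto 8) (upto 4).

(* Every line of seven cells crosses one of the strips of height 4 (or, if it is
   horizontal, one of the tiles) completely; where a diagonal crossing is split between
   two neighbouring tiles, the larger part is kept, and of two parts of size 2 only one. *)
Definition tile_edges : list (list point) :=
  map (segment 4 (1,0)) (list_prod [0;4] (upto 4)) ++
  map (segment 4 (0,1)) (list_prod (upto 8) [0]) ++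
  map (segment 4 (1,1)) (list_prod (upto 5) [0]) ++
  map (segment 4 (1,-1)) (list_prod (upto 5) [3]) ++
  [segment 3 (1,1) (5,0); segment 3 (1,1) (0,1); segment 2 (1,1) (0,2);
   segment 3 (1,-1) (5,3); segment 3 (1,-1) (0,2); segment 2 (1,-1) (6,3)].

(** A certificate in the coordinates of the model rectangle, whose correctness rests only on the
    evaluation of [wins_with]. *)
Definition tile_strategy : strategy :=
  Offer (0,2) (1,3) (Offer (2,0) (1,1) (Offer (7,2) (6,3) (Offer (5,0) (6,1) (Offer (1,2) (2,2)
  (Offer (0,1) (2,3) (Offer (0,0) (0,3) (Offer (1,0) (3,0) (Offer (7,1) (6,2) Pairing
  (Offer (4,2) (5,2) Pairing Pairing)) (Offer (4,0) (6,0) (Offer (6,2) (5,3) Pairing Pairing)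
  (Offer (4,2) (5,3) Pairing Pairing))) (Offer (3,0) (2,1) (Offer (4,0) (6,0) (Offer (6,2) (5,3)
  Pairing Pairing) (Offer (4,2) (5,3) Pairing Pairing)) (Offer (7,1) (6,2) Pairing
  (Offer (4,2) (5,2) Pairing Pairing)))) (Offer (4,1) (3,2) (Offer (5,1) (5,2) (Offer (7,0) (7,3)
  (Offer (4,0) (6,0) Pairing Pairing) (Offer (4,0) (6,2) Pairing Pairing)) (Offer (4,2) (6,2)
  Pairing Pairing)) (Offer (4,2) (5,3) (Offer (5,2) (6,2) Pairing (Offer (6,0) (5,1) Pairing
  Pairing)) (Offer (5,1) (5,2) (Offer (7,1) (6,2) Pairing Pairing) Pairing)))) (Offer (2,1) (2,3)
  (Offer (6,2) (5,3) (Offer (4,2) (5,2) (Offer (6,0) (5,1) Pairing Pairing) Pairing)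
  (Offer (3,1) (4,2) Pairing Pairing)) (Offer (4,1) (3,2) (Offer (5,1) (5,2) (Offer (7,0) (7,1)
  (Offer (4,0) (6,0) Pairing Pairing) (Offer (6,2) (5,3) Pairing Pairing)) (Offer (4,2) (6,2)
  Pairing Pairing)) (Offer (4,0) (6,0) (Offer (6,2) (5,3) Pairing Pairing) (Offer (4,2) (5,3)
  Pairing Pairing))))) (Offer (2,2) (2,3) (Offer (1,2) (3,2) (Offer (7,1) (6,2) Pairing Pairing)
  (Offer (6,2) (5,3) (Offer (4,2) (5,2) (Offer (4,0) (4,1) Pairing Pairing) (Offer (7,0) (4,3)
  (Offer (7,1) (7,3) Pairing Pairing) Pairing)) (Offer (3,1) (4,2) Pairing Pairing)))
  (Offer (0,1) (1,2) (Offer (0,0) (0,3) (Offer (1,0) (3,0) (Offer (7,1) (6,2) Pairing Pairing)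
  (Offer (7,1) (6,2) (Offer (4,1) (5,1) Pairing Pairing) (Offer (4,2) (5,2) Pairing Pairing)))
  (Offer (7,1) (6,2) Pairing Pairing)) (Offer (3,1) (5,3) (Offer (7,0) (4,3) Pairing
  (Offer (3,0) (3,2) Pairing Pairing)) (Offer (7,1) (6,2) Pairing Pairing))))) (Offer (4,1) (5,2)
  (Offer (4,3) (5,3) (Offer (4,0) (4,2) (Offer (3,2) (2,3) (Offer (1,0) (2,1) Pairing Pairing)
  (Offer (0,1) (1,2) Pairing Pairing)) (Offer (2,1) (2,2) (Offer (1,0) (3,2) (Offer (0,0) (3,0)
  Pairing Pairing) (Offer (5,0) (2,3) Pairing (Offer (0,1) (1,2) Pairing (Offer (3,0) (0,3)
  (Offer (3,1) (3,3) Pairing (Offer (6,0) (5,1) Pairing Pairing)) Pairing)))) (Offer (1,2) (3,2)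
  Pairing Pairing))) (Offer (3,1) (4,2) (Offer (7,1) (6,2) (Offer (5,1) (6,1) (Offer (0,1) (1,2)
  Pairing (Offer (2,2) (3,2) Pairing Pairing)) (Offer (0,1) (1,2) Pairing (Offer (2,2) (3,2)
  Pairing Pairing))) (Offer (6,0) (6,1) (Offer (0,1) (1,2) Pairing (Offer (2,2) (3,2) Pairing
  Pairing)) (Offer (0,1) (1,2) Pairing (Offer (2,2) (3,2) Pairing Pairing)))) (Offer (7,1) (6,2)
  (Offer (5,1) (6,1) (Offer (6,0) (3,3) (Offer (1,2) (2,3) Pairing Pairing) (Offer (1,2) (2,3)
  Pairing Pairing)) (Offer (1,2) (2,3) Pairing Pairing)) (Offer (6,0) (6,1) (Offer (5,1) (3,3)
  (Offer (4,0) (7,3) (Offer (5,0) (7,0) (Offer (3,2) (2,3) Pairing (Offer (0,1) (1,2) Pairing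
  Pairing)) (Offer (0,1) (2,3) Pairing Pairing)) (Offer (1,2) (2,3) Pairing Pairing))
  (Offer (1,2) (2,3) Pairing Pairing)) (Offer (1,2) (2,3) Pairing Pairing))))) (Offer (0,1) (2,3)
  (Offer (0,0) (0,3) (Offer (1,0) (3,0) (Offer (6,2) (5,3) Pairing (Offer (5,0) (5,1) Pairing
  Pairing)) (Offer (6,2) (5,3) Pairing (Offer (5,0) (5,1) Pairing (Offer (3,1) (4,2) Pairing
  Pairing)))) (Offer (3,0) (2,1) (Offer (6,2) (5,3) Pairing (Offer (5,0) (5,1) Pairing
  (Offer (3,1) (4,2) Pairing Pairing))) (Offer (6,2) (5,3) Pairing (Offer (5,0) (5,1) Pairing
  Pairing)))) (Offer (2,1) (2,2) (Offer (3,1) (4,2) (Offer (4,3) (5,3) (Offer (7,0) (6,1)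
  (Offer (1,0) (3,2) Pairing Pairing) (Offer (1,0) (3,2) Pairing Pairing)) (Offer (5,0) (5,1)
  Pairing Pairing)) (Offer (6,2) (5,3) (Offer (6,0) (6,1) Pairing Pairing) (Offer (5,0) (5,1)
  Pairing Pairing))) (Offer (1,2) (3,2) (Offer (6,2) (5,3) Pairing (Offer (5,0) (5,1) Pairing
  Pairing)) (Offer (6,2) (5,3) Pairing (Offer (5,0) (5,1) Pairing (Offer (3,1) (4,2) Pairing
  Pairing)))))))) (Offer (7,2) (6,3) (Offer (5,0) (6,1) (Offer (5,2) (5,3) (Offer (4,2) (6,2)
  (Offer (1,2) (2,3) (Offer (2,2) (3,2) (Offer (0,0) (3,3) (Offer (0,1) (0,3) Pairing Pairing)
  Pairing) (Offer (3,0) (3,1) Pairing Pairing)) (Offer (4,1) (3,2) Pairing Pairing))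
  (Offer (0,1) (1,2) Pairing Pairing)) (Offer (7,1) (6,2) (Offer (7,0) (7,3) (Offer (4,0) (6,0)
  (Offer (0,1) (1,2) (Offer (2,1) (3,1) Pairing Pairing) (Offer (2,2) (3,2) Pairing Pairing))
  (Offer (0,1) (1,2) Pairing Pairing)) (Offer (0,1) (1,2) Pairing Pairing)) (Offer (4,1) (2,3)
  (Offer (0,0) (3,3) Pairing (Offer (4,0) (4,2) Pairing Pairing)) (Offer (0,1) (1,2) Pairing
  Pairing)))) (Offer (0,0) (2,2) (Offer (0,1) (0,3) (Offer (2,1) (3,1) (Offer (1,2) (2,3)
  (Offer (7,1) (6,2) Pairing Pairing) (Offer (7,1) (6,2) Pairing Pairing)) (Offer (1,2) (2,3)
  (Offer (7,1) (6,2) Pairing Pairing) (Offer (7,1) (6,2) Pairing Pairing))) (Offer (7,1) (6,2)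
  Pairing Pairing)) (Offer (1,2) (3,2) (Offer (0,1) (2,3) (Offer (2,1) (3,1) (Offer (3,0) (0,3)
  (Offer (7,1) (6,2) Pairing Pairing) (Offer (7,1) (6,2) Pairing Pairing)) (Offer (7,1) (6,2)
  Pairing Pairing)) (Offer (7,1) (6,2) Pairing Pairing)) (Offer (7,1) (6,2) (Offer (4,1) (5,1)
  Pairing Pairing) (Offer (4,2) (5,2) Pairing Pairing))))) (Offer (6,0) (6,2) (Offer (3,0) (4,1)
  (Offer (2,1) (3,1) (Offer (1,2) (0,3) (Offer (2,2) (3,2) Pairing Pairing) Pairing)
  (Offer (3,2) (3,3) Pairing Pairing)) (Offer (5,0) (2,3) (Offer (4,0) (7,0) (Offer (4,2) (4,3)
  Pairing Pairing) (Offer (5,2) (4,3) Pairing Pairing)) (Offer (0,1) (1,2) Pairing Pairing)))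
  (Offer (7,1) (5,3) (Offer (0,1) (1,2) (Offer (2,1) (3,1) Pairing (Offer (0,0) (0,3)
  (Offer (2,2) (3,3) Pairing (Offer (3,0) (3,2) (Offer (4,1) (5,2) Pairing Pairing) Pairing))
  Pairing)) (Offer (2,2) (3,2) Pairing (Offer (3,0) (4,1) Pairing Pairing))) (Offer (4,3) (7,3)
  (Offer (0,1) (1,2) (Offer (2,1) (3,1) Pairing (Offer (0,0) (0,3) (Offer (2,2) (3,3) Pairing
  (Offer (3,0) (3,2) Pairing Pairing)) Pairing)) (Offer (2,2) (3,2) Pairing (Offer (1,0) (2,1)
  Pairing (Offer (3,0) (0,3) (Offer (4,1) (5,2) Pairing Pairing) Pairing)))) (Offer (4,0) (5,1)
  (Offer (0,1) (1,2) Pairing Pairing) (Offer (5,0) (5,2) (Offer (0,1) (1,2) Pairing Pairing)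
  (Offer (3,0) (4,1) (Offer (0,0) (0,3) (Offer (2,2) (3,3) Pairing Pairing) (Offer (2,1) (1,2)
  Pairing Pairing)) Pairing)))))))) (Offer (7,2) (6,3) (Offer (5,0) (6,1) (Offer (3,1) (2,2)
  (Offer (2,3) (3,3) (Offer (0,1) (1,2) (Offer (1,1) (2,1) (Offer (4,1) (3,2) (Offer (7,1) (6,2)
  Pairing (Offer (4,2) (5,2) Pairing Pairing)) (Offer (6,2) (5,3) Pairing Pairing))
  (Offer (4,1) (3,2) (Offer (7,1) (6,2) Pairing (Offer (4,2) (5,2) Pairing Pairing))
  (Offer (1,0) (4,3) (Offer (6,2) (5,3) Pairing Pairing) (Offer (6,2) (5,3) Pairing Pairing))))
  (Offer (1,0) (1,1) (Offer (4,1) (3,2) (Offer (7,1) (6,2) Pairing (Offer (4,2) (5,2) Pairing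
  Pairing)) (Offer (2,1) (4,3) (Offer (3,0) (0,3) (Offer (0,0) (2,0) (Offer (7,1) (6,2) Pairing
  Pairing) (Offer (4,2) (5,3) Pairing (Offer (5,1) (5,2) (Offer (7,1) (6,2) Pairing Pairing)
  Pairing))) (Offer (6,2) (5,3) Pairing Pairing)) (Offer (6,2) (5,3) Pairing Pairing)))
  (Offer (4,1) (3,2) (Offer (7,1) (6,2) Pairing (Offer (4,2) (5,2) Pairing Pairing))
  (Offer (6,2) (5,3) Pairing Pairing)))) (Offer (3,0) (3,2) (Offer (4,2) (5,3) (Offer (6,0) (5,1)
  Pairing Pairing) (Offer (5,1) (5,2) (Offer (7,1) (6,2) Pairing Pairing) Pairing))
  (Offer (5,1) (5,2) (Offer (6,0) (4,2) (Offer (4,0) (7,0) Pairing Pairing) (Offer (2,0) (5,3)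
  Pairing (Offer (7,1) (6,2) Pairing (Offer (4,0) (7,3) (Offer (4,1) (4,3) Pairing
  (Offer (1,0) (2,1) Pairing Pairing)) Pairing)))) (Offer (4,2) (6,2) Pairing Pairing))))
  (Offer (7,1) (5,3) (Offer (7,0) (7,3) (Offer (4,0) (6,0) (Offer (1,2) (2,3) Pairing
  (Offer (2,0) (2,1) Pairing (Offer (4,1) (3,2) Pairing Pairing))) (Offer (1,2) (2,3) Pairing
  (Offer (2,0) (2,1) Pairing Pairing))) (Offer (4,0) (5,1) (Offer (1,2) (2,3) Pairing
  (Offer (2,0) (2,1) Pairing (Offer (4,1) (3,2) Pairing Pairing))) (Offer (1,2) (2,3) Pairing
  (Offer (2,0) (2,1) Pairing Pairing)))) (Offer (5,1) (5,2) (Offer (0,3) (3,3) (Offer (1,2) (2,3)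
  Pairing Pairing) (Offer (0,0) (1,1) (Offer (6,0) (4,2) Pairing (Offer (2,0) (2,3) Pairing
  Pairing)) (Offer (1,0) (1,2) (Offer (6,0) (4,2) Pairing (Offer (2,1) (4,3) Pairing Pairing))
  (Offer (6,0) (4,2) Pairing Pairing)))) (Offer (4,2) (6,2) (Offer (1,2) (2,3) Pairing
  (Offer (2,0) (2,1) Pairing (Offer (4,1) (3,2) Pairing Pairing))) (Offer (1,2) (2,3) Pairing
  (Offer (2,0) (2,1) Pairing Pairing)))))) (Offer (1,0) (1,2) (Offer (4,0) (3,1)
  (Offer (4,1) (5,1) (Offer (4,2) (4,3) Pairing Pairing) (Offer (6,2) (7,3) (Offer (4,2) (5,2)
  Pairing Pairing) Pairing)) (Offer (2,0) (5,3) (Offer (0,0) (3,0) (Offer (2,2) (3,3) Pairing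
  Pairing) (Offer (3,2) (3,3) Pairing Pairing)) (Offer (7,1) (6,2) Pairing Pairing)))
  (Offer (0,1) (2,3) (Offer (4,0) (2,2) (Offer (4,1) (4,3) (Offer (5,1) (7,1) Pairing Pairing)
  (Offer (7,0) (5,2) (Offer (7,1) (7,3) Pairing Pairing) (Offer (4,2) (6,2) Pairing Pairing)))
  (Offer (4,2) (6,2) Pairing Pairing)) (Offer (0,3) (3,3) (Offer (3,0) (2,1) (Offer (7,1) (6,2)
  Pairing Pairing) (Offer (2,0) (2,2) (Offer (7,1) (6,2) Pairing Pairing) (Offer (4,0) (3,1)
  (Offer (4,1) (5,1) (Offer (4,2) (4,3) Pairing Pairing) (Offer (6,2) (7,3) Pairing Pairing))
  Pairing))) (Offer (7,1) (6,2) (Offer (4,1) (5,1) (Offer (7,0) (7,3) (Offer (5,2) (4,3) Pairing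
  (Offer (4,0) (4,2) Pairing Pairing)) Pairing) Pairing) (Offer (4,2) (5,2) (Offer (6,0) (5,1)
  Pairing (Offer (4,0) (7,3) (Offer (3,1) (2,2) Pairing Pairing) Pairing)) Pairing))))))
  (Offer (3,0) (4,1) (Offer (3,1) (3,3) (Offer (4,0) (2,2) (Offer (1,1) (1,2) (Offer (0,1) (2,1)
  (Offer (6,2) (5,3) Pairing Pairing) (Offer (6,2) (7,3) (Offer (6,0) (6,1) Pairing Pairing)
  (Offer (4,3) (5,3) Pairing Pairing))) (Offer (2,1) (0,3) (Offer (0,1) (2,3) (Offer (6,2) (7,3)
  (Offer (6,0) (6,1) Pairing Pairing) (Offer (4,3) (5,3) Pairing Pairing)) (Offer (6,2) (7,3)
  (Offer (6,0) (6,1) Pairing Pairing) (Offer (4,3) (5,3) Pairing Pairing))) (Offer (0,1) (2,3)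
  (Offer (6,2) (5,3) Pairing Pairing) (Offer (6,2) (5,3) Pairing Pairing)))) (Offer (1,0) (2,0)
  (Offer (1,1) (1,2) Pairing Pairing) (Offer (2,1) (2,3) Pairing Pairing))) (Offer (0,3) (2,3)
  (Offer (2,1) (1,2) (Offer (6,0) (6,2) Pairing Pairing) (Offer (1,0) (1,1) (Offer (0,0) (2,0)
  (Offer (6,0) (6,2) Pairing Pairing) (Offer (6,0) (6,2) Pairing Pairing)) (Offer (0,0) (2,2)
  (Offer (6,0) (6,2) Pairing Pairing) (Offer (6,0) (6,2) Pairing Pairing)))) (Offer (0,1) (1,2)
  (Offer (6,2) (5,3) (Offer (6,0) (6,1) Pairing Pairing) (Offer (4,3) (7,3) (Offer (0,0) (2,2)
  Pairing Pairing) Pairing)) (Offer (1,0) (1,1) (Offer (0,0) (2,0) (Offer (6,2) (5,3) Pairing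
  Pairing) (Offer (2,1) (2,2) (Offer (3,2) (4,3) Pairing (Offer (5,3) (7,3) (Offer (7,1) (6,2)
  Pairing (Offer (6,0) (6,1) Pairing Pairing)) (Offer (6,1) (6,2) Pairing Pairing)))
  (Offer (6,0) (6,2) Pairing Pairing))) (Offer (0,0) (2,2) (Offer (6,0) (6,2) Pairing Pairing)
  (Offer (2,0) (2,1) (Offer (6,0) (6,2) Pairing Pairing) (Offer (6,0) (6,2) Pairing Pairing)))))))
  (Offer (4,0) (3,1) (Offer (4,2) (4,3) (Offer (5,1) (6,2) (Offer (6,1) (7,1) (Offer (6,0) (3,3)
  Pairing Pairing) (Offer (6,0) (3,3) Pairing Pairing)) Pairing) (Offer (5,3) (7,3)
  (Offer (7,1) (6,2) (Offer (5,1) (6,1) (Offer (5,0) (5,2) (Offer (6,0) (7,0) (Offer (3,2) (2,3)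
  Pairing Pairing) (Offer (3,2) (2,3) Pairing Pairing)) Pairing) (Offer (7,0) (5,2)
  (Offer (5,0) (6,0) (Offer (3,2) (2,3) Pairing Pairing) Pairing) (Offer (1,0) (3,2) Pairing
  Pairing))) (Offer (6,0) (6,1) (Offer (5,0) (7,0) (Offer (5,1) (5,2) (Offer (3,2) (2,3) Pairing
  Pairing) (Offer (3,2) (2,3) Pairing Pairing)) Pairing) (Offer (7,0) (5,2) (Offer (1,0) (3,2)
  Pairing Pairing) (Offer (5,0) (5,1) (Offer (3,2) (2,3) Pairing Pairing) Pairing))))
  (Offer (5,1) (6,2) (Offer (6,1) (7,1) (Offer (7,0) (5,2) (Offer (5,0) (6,0) (Offer (3,2) (2,3)
  Pairing Pairing) Pairing) (Offer (1,0) (3,2) Pairing Pairing)) (Offer (1,0) (1,2) Pairing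
  Pairing)) (Offer (6,0) (6,1) (Offer (5,0) (7,0) (Offer (3,2) (2,3) Pairing Pairing) Pairing)
  (Offer (7,0) (5,2) (Offer (1,0) (3,2) Pairing Pairing) (Offer (1,0) (3,2) Pairing Pairing))))))
  (Offer (2,3) (5,3) (Offer (0,1) (1,2) (Offer (1,1) (2,1) Pairing Pairing) (Offer (1,0) (1,1)
  Pairing Pairing)) (Offer (2,0) (4,2) (Offer (7,1) (6,2) (Offer (5,1) (6,1) Pairing Pairing)
  Pairing) (Offer (7,1) (6,2) (Offer (5,1) (6,1) Pairing Pairing) (Offer (6,0) (6,1) Pairing
  Pairing))))))).

Lemma tile_wins : picker_wins tile_cells (hits tile_edges).
Proof.
  apply wins_with_sound with tile_strategy tile_edges.
  - vm_compute; reflexivity.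
  - repeat (constructor; [simpl; intuition discriminate|]). constructor.
  - intros X _ HX; exact HX.
Qed.

(** * Tiling the plane by rectangles *)

Definition place (t x : point) : point := (8 * fst t + fst x, 4 * snd t + snd x).

Definition tile (t : point) : list point := map (place t) tile_cells.

(** Division rounds down, so negative coordinates are covered as well. *)
Definition tile_of (p : point) : point := (fst p / 8, snd p / 4).

Lemma place_inj t x y : place t x = place t y -> x = y.
Proof.
  destruct x, y. unfold place; cbn [fst snd]. intros H; injection H. intros. f_equal; lia.
Qed.

Lemma in_upto n k : In k (upto n) <-> 0 <= k < Z.of_nat n.
Proof.
  unfold upto. rewrite in_map_iff. split.
  - intros (i & <- & Hi). apply in_seq in Hi. lia.
  - intros Hk. exists (Z.to_nat k). rewrite in_seq. lia.
Qed.

Lemma in_tile_cells x : In x tile_cells <-> 0 <= fst x < 8 /\ 0 <= snd x < 4.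
Proof.
  destruct x as [i j]. etransitivity; [apply in_prod_iff|].
  now rewrite !in_upto.
Qed.

Lemma tile_of_place t x : In x tile_cells -> tile_of (place t x) = t.
Proof.
  intros Hx. apply in_tile_cells in Hx as [Hx Hy]. destruct t as [i j].
  unfold tile_of, place; cbn [fst snd]. f_equal.
  - apply eq_sym, Z.div_unique with (fst x); lia.
  - apply eq_sym, Z.div_unique with (snd x); lia.
Qed.

Lemma place_tile_of p : exists x, In x tile_cells /\ place (tile_of p) x = p.
Proof.
  exists (fst p mod 8, snd p mod 4). split.
  - apply in_tile_cells; simpl. split; apply Z.mod_pos_bound; lia.
  - destruct p as [x y]. unfold place, tile_of; cbn [fst snd]. f_equal.
    + symmetry; apply Z.div_mod; lia.
    + symmetry; apply Z.div_mod; lia.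
Qed.

(** Chooser's winning condition stated without a board, so that games on different boards can be
    compared. *)
Definition line (X : point -> Prop) : Prop :=
  exists p d, In d dirs /\ forall k, 0 <= k <= 6 -> X (pt_step p d k).

Lemma upward_line : upward line.
Proof. intros X Y HXY (p & d & Hd & H). exists p, d; auto. Qed.

Lemma tile_edges_in_cells e x : In e tile_edges -> In x e -> In x tile_cells.
Proof.
  intros He Hx. destruct (mem_spec x tile_cells) as [|Hn]; trivial. exfalso.
  assert (H : forallb (forallb (fun x => mem x tile_cells)) tile_edges = true)
    by (vm_compute; reflexivity).
  rewrite forallb_forall in H. specialize (H e He). rewrite forallb_forall in H.
  specialize (H x Hx). now destruct (mem_spec x tile_cells).
Qed.

(** A cell of a completed set is what later identifies its tile as one of those in play. *)
Lemma tile_edge_nonempty e : In e tile_edges -> exists x, In x e.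
Proof.
  intros He. destruct e as [|x e]; [|exists x; now left]. exfalso.
  assert (H : forallb (fun e => negb (Nat.eqb (length e) 0)) tile_edges = true)
    by (vm_compute; reflexivity).
  rewrite forallb_forall in H. now specialize (H [] He).
Qed.

Definition edge_in_segment (p d : point) (t : point) (e : list point) : bool :=
  forallb (fun x => mem (place t x) (segment 7 d p)) e.

Lemma line_contains_edge_near p d :
  In p tile_cells -> In d dirs ->
  exists t e, In e tile_edges /\ edge_in_segment p d t e = true.
Proof.
  intros Hp Hd.
  (* A finite check of 4 directions and 32 starting cells. Neighbouring tiles suffice: among seven
     consecutive rows there is a full strip at offset -1, 0 or 1, and a line extends at most 6
     columns to the right. *)
  assert (H : forallb (fun d => forallb (fun p =>
            existsb (fun t => existsb (edge_in_segment p d t) tile_edges)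
              (list_prod [-1;0;1] [-1;0;1]))
          tile_cells) dirs = true) by (vm_compute; reflexivity).
  rewrite forallb_forall in H. specialize (H d Hd).
  rewrite forallb_forall in H. specialize (H p Hp).
  apply existsb_exists in H as (t & _ & H).
  apply existsb_exists in H as (e & He & H). eauto.
Qed.

(** Translation by the tile of the starting cell reduces this to lines starting in the model
    rectangle. *)
Lemma line_contains_edge X :
  line X -> exists t e, In e tile_edges /\ forall x, In x e -> X (place t x).
Proof.
  intros (p & d & Hd & HX).
  destruct (place_tile_of p) as (q & Hq & Hp).
  set (s := tile_of p) in Hp. clearbody s.
  destruct (line_contains_edge_near q d Hq Hd) as (t & e & He & H).
  exists (fst s + fst t, snd s + snd t), e.
  split; trivial. intros x Hx.
  unfold edge_in_segment in H. rewrite forallb_forall in H. specialize (H x Hx).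
  destruct (mem_spec (place t x) (segment 7 d q)) as [Hin|]; [|discriminate].
  apply in_map_iff in Hin as (k & Hk & Hk7). apply in_upto in Hk7.
  replace (place _ x) with (pt_step p d k); [apply HX; lia|].
  rewrite <- Hp. revert Hk. unfold place, pt_step; cbn [fst snd].
  intros [Hx1 Hx2]%pair_equal_spec. f_equal; lia.
Qed.

Definition tile_hit (t : point) (X : point -> Prop) : Prop :=
  hits tile_edges (fun x => X (place t x)).

Lemma upward_tile_hit t : upward (tile_hit t).
Proof. intros X Y HXY. apply upward_hits. auto. Qed.

Lemma tiles_win ts :
  NoDup ts ->
  picker_wins (flat_map tile ts)
    (fun X => exists t, In t ts /\ tile_hit t X).
Proof.
  induction 1 as [|t ts Ht _ IH].
  - apply wins_short; [simpl; lia|]. now intros (t & [] & _).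
  - apply (picker_wins_union _ (tile t) (flat_map tile ts))
      with (b1 := tile_hit t) (b2 := fun X => exists t, In t ts /\ tile_hit t X).
    + apply (picker_wins_map _ _ (place t) tile_cells (hits tile_edges));
        [apply place_inj | apply upward_hits | apply tile_wins].
    + exact IH.
    (* A tile has 32 = 2 * 16 cells. *)
    + exists 16%nat. reflexivity.
    (* Distinct tiles are disjoint because [tile_of] recovers the tile from any of its cells. *)
    + intros x Hx Hx'. apply Ht. apply in_map_iff in Hx as (y & <- & Hy).
      apply in_flat_map in Hx' as (t' & Ht' & Hx').
      apply in_map_iff in Hx' as (y' & E & Hy').
      apply (f_equal tile_of) in E. rewrite !tile_of_place in E; trivial.
      now subst.
    + apply upward_tile_hit.
    + intros X Y HXY (t' & Ht' & H). exists t'. split; trivial.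
      revert H; now apply upward_tile_hit.
    + intros X _ (t' & [<-|Ht'] & e & He & HX).
      * left. exists e. split; trivial. intros x Hx. split; auto.
        apply in_map. eauto using tile_edges_in_cells.
      * right. exists t'. split; trivial. exists e. split; trivial.
        intros x Hx. split; auto. apply in_flat_map. exists t'. split; trivial.
        apply in_map. eauto using tile_edges_in_cells.
Qed.

Lemma point_eq_dec (p q : point) : {p = q} + {p <> q}.
Proof. destruct (pt_eqb_spec p q); auto. Qed.

Lemma line_game_wins A : NoDup A -> picker_wins A line.
Proof.
  intros HA.
  (* The tiles that meet [A]; their union is a finite board containing [A]. *)
  set (ts := nodup point_eq_dec (map tile_of A)).
  apply picker_wins_subset with (flat_map tile ts);
    trivial.
  - apply upward_line.
  - eapply picker_wins_mono; [apply tiles_win, NoDup_nodup|].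
    (* The set found in the line lies in some tile [t]; since Chooser owns only cells of the union,
       [t] is among [ts]. *)
    intros X HX H. destruct (line_contains_edge X H) as (t & e & He & HeX).
    exists t. split; [|exists e; auto].
    destruct (tile_edge_nonempty e He) as [x Hx].
    specialize (HX _ (HeX x Hx)). apply in_flat_map in HX as (t' & Ht' & Hx').
    apply in_map_iff in Hx' as (y & E & Hy). apply (f_equal tile_of) in E.
    rewrite !tile_of_place in E; eauto using tile_edges_in_cells. now subst.
  - intros p Hp. apply in_flat_map. exists (tile_of p). split.
    + apply nodup_In, in_map, Hp.
    + destruct (place_tile_of p) as (x & Hx & E). apply in_map_iff. eauto.
Qed.

(** * Return to the concrete game *)

(** The cells [C] already owned are absorbed into [b], which must hold whenever they complete a line
    together with later cells. The permutation bridges the order of free cells left by [rem2]. *)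
Lemma picker_wins_PickerWins A F b :
  picker_wins F b -> forall F' C,
  NoDup F' -> Permutation F F' ->
  (forall X, line (fun x => X x \/ In x C) -> b X) ->
  PickerWins A F' C.
Proof.
  assert (Howns : forall C, chooser_owns_edge A C -> line (fun x => In x C)).
  { intros C (p & d & [Hd _] & HC). exists p, d; auto. }
  induction 1 as [F b HF Hn | F G b u v HF _ IHu _ IHv]; intros F' C HF' HP Hb.
  - rewrite (Permutation_length HP) in HF.
    (* With at most one cell left, [F' ++ C] is Chooser's final set, which covers both [pw_end] and
       [pw_last]. *)
    assert (HnF : ~ chooser_owns_edge A (F' ++ C)).
    { intros H. apply Hn, Hb. apply Howns in H. revert H; apply upward_line.
      intros x Hx. rewrite HP. now apply in_app_or. }
    destruct F' as [|v [|? ?]]; [| |simpl in HF; lia]; now constructor.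
  - assert (HQ : Permutation (u :: v :: G) F') by now rewrite <- HF.
    assert (Huv : NoDup (u :: v :: G))
      by (apply (Permutation_NoDup (Permutation_sym HQ) HF')).
    assert (Hne : u <> v).
    { intros ->. apply NoDup_cons_iff in Huv as [Huv _]. apply Huv; now left. }
    assert (Hu : In u F') by (rewrite <- HQ; now left).
    assert (Hv : In v F') by (rewrite <- HQ; right; now left).
    assert (HG : Permutation G (rem2 u v F')).
    { do 2 eapply Permutation_cons_inv. rewrite HQ. now apply rem2_perm. }
    apply pw_move with u v; trivial; [apply IHu | apply IHv];
      trivial; try now apply NoDup_filter.
    + intros X H. apply Hb. revert H; apply upward_line.
      unfold add; simpl; intuition.
    + intros X H. apply Hb. revert H; apply upward_line.
      unfold add; simpl; intuition.
Qed.

Theorem theorem4p1 : forall A : list point, NoDup A -> PickerWins A A [].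
Proof.
  intros A HA. apply picker_wins_PickerWins with A line; trivial.
  - now apply line_game_wins.
  - intros X. apply upward_line. simpl; intuition.
Qed.
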